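(* Let $\epsilon>0$, and let $M=(M_d)_{d\in\mathbb{Z}}$ be a graded q-tame persistence module with finite cap numbers $c_d^{\epsilon}$ and finite essential dimensions $p_d$ for all $d$. If $\mathfrak{m}_d(-\infty,p)=0$ for all $p\in\mathbb{R}\cup\{\infty\}$ and all $d$, then for any dimension $n$ the Morse inequality $$\sum_{d=0}^{n}(-1)^{n-d}\,(c_d^{\epsilon}-p_d)\ \ge\ 0$$ holds.
   Context: Fix a field $\mathbb{F}$. A persistence module is a functor from the poset $(\mathbb{R},\le)$ to $\mathbb{F}$-vector spaces; it is q-tame if all structure maps $M_{s,t}\colon M_s\to M_t$ with $s<t$ have finite rank. A graded persistence module is a family of persistence modules indexed by the integers, and it is q-tame if each member is. Persistence diagrams: the radical of a persistence module $M$ is the submodule $(\operatorname{rad}M)_t=\sum_{s<t}\operatorname{im}M_{s,t}$. For an interval $I\subseteq\mathbb{R}$, the interval module $C(I)$ is $\mathbb{F}$ at $t\in I$ and $0$ otherwise, with identity maps within $I$ and zero maps otherwise. It is known that the radical of a q-tame persistence module is isomorphic to a direct sum $\bigoplus_{\lambda\in\Lambda}C(I_\lambda)$ of interval modules, with the multiset of intervals uniquely determined. Let $\mathcal{E}=\{(p,q)\mid p\in\mathbb{R}\cup\{-\infty\},\ q\in\mathbb{R}\cup\{+\infty\},\ p<q\}$. The persistence diagram is given by the multiplicity function $\mathfrak{m}\colon\mathcal{E}\to\mathbb{N}$, where $\mathfrak{m}(p,q)$ is the number of $\lambda\in\Lambda$ with $\inf I_\lambda=p$ and $\sup I_\lambda=q$.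 Write $\mathfrak{m}_d$ for the multiplicity function of the degree $d$ part $M_d$. For $\epsilon>0$ define $$\alpha_d^{\epsilon}=\sum_{\substack{(p,q)\in\mathcal{E}\\ q-p>\epsilon,\ p\ne-\infty}}\mathfrak{m}_d(p,q),\qquad \omega_d^{\epsilon}=\sum_{\substack{(p,q)\in\mathcal{E}\\ q-p>\epsilon,\ q\ne\infty}}\mathfrak{m}_d(p,q).$$ The $(d,\epsilon)$-cap number is $c_d^{\epsilon}=\alpha_d^{\epsilon}+\omega_{d-1}^{\epsilon}$, and the essential dimension is $p_d=\sum_{p\in\mathbb{R}\cup\{-\infty\}}\mathfrak{m}_d(p,\infty)$.
   Formalization: For odd n the formal theorem also assumes that the degree −1 sum ω_{-1}^ε is 0 (automatic if M_d=0 for d<0); without it the claim fails, e.g. ε=1, M_{-1}=C([0,2)), all other M_d=0, n=1 gives −1. *)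

(* Defs.v *)
From HB Require Import structures.
From mathcomp Require Import all_boot all_order all_algebra.
From mathcomp Require Import all_classical all_reals all_analysis.

Set Implicit Arguments.
Unset Strict Implicit.
Unset Printing Implicit Defensive.

Import Order.TTheory GRing.Theory Num.Theory.

Local Open Scope classical_set_scope.
Local Open Scope ring_scope.

(* {vspace V} requires V to be finite dimensional; here V is arbitrary. *)
Record subspace (F : fieldType) (V : lmodType F) := Subspace {
  sub_set : set V;
  sub_set0 : sub_set 0;
  sub_setP : forall (a : F) (x y : V),
    sub_set x -> sub_set y -> sub_set (a *: x + y)
}.

Definition sub_pred (F : fieldType) (V : lmodType F) (S : subspace V) :
  {pred V} := fun x => `[< sub_set S x >].

Lemma sub_pred_closed (F : fieldType) (V : lmodType F) (S : subspace V) :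
  submod_closed (sub_pred S).
Proof.
split; first exact/asboolP/sub_set0.
move=> a x y /asboolP Sx /asboolP Sy; exact/asboolP/sub_setP.
Qed.

HB.instance Definition _ (F : fieldType) (V : lmodType F) (S : subspace V) :=
  GRing.isSubmodClosed.Build F V (sub_pred S) (sub_pred_closed S).

Record sub_type (F : fieldType) (V : lmodType F) (S : subspace V) := SubElt {
  sub_val : V;
  sub_valP : sub_val \in sub_pred S
}.

HB.instance Definition _ (F : fieldType) (V : lmodType F) (S : subspace V) :=
  [isSub for @sub_val F V S].
HB.instance Definition _ (F : fieldType) (V : lmodType F) (S : subspace V) :=
  [Choice of sub_type S by <:].
HB.instance Definition _ (F : fieldType) (V : lmodType F) (S : subspace V) :=
  [SubChoice_isSubLmodule of sub_type S by <:].

Lemma sub_val_inj (F : fieldType) (V : lmodType F) (S : subspace V) :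
  injective (@sub_val F V S).
Proof. exact: val_inj. Qed.

Section SubMap.
Variables (F : fieldType) (V W : lmodType F) (S : subspace V) (T : subspace W).
Variables (f : {linear V -> W}) (fST : forall x, sub_set S x -> sub_set T (f x)).

Lemma sub_map_subproof (x : sub_type S) : f (sub_val x) \in sub_pred T.
Proof. by case: x => x /= /asboolP Sx; apply/asboolP/fST. Qed.

Definition sub_map (x : sub_type S) : sub_type T :=
  SubElt (sub_map_subproof x).

Lemma sub_map_linear : linear sub_map.
Proof. by move=> a x y; apply: sub_val_inj; rewrite /= linearP. Qed.

HB.instance Definition _ :=
  GRing.isLinear.Build F (sub_type S) (sub_type T) _ sub_map sub_map_linear.

End SubMap.

(* The product of an arbitrary family of vector spaces. *)
Section DProd.
Variables (F : fieldType) (L : Type) (V : L -> lmodType F).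

Definition dprod := forall l, V l.

HB.instance Definition _ := gen_eqMixin dprod.
HB.instance Definition _ := gen_choiceMixin dprod.

Let dadd (f g : dprod) : dprod := fun l => f l + g l.
Let dopp (f : dprod) : dprod := fun l => - f l.
Let dzero : dprod := fun l => 0.
Let dscale (a : F) (f : dprod) : dprod := fun l => a *: f l.

Let daddA : associative dadd.
Proof. by move=> f g h; apply: functional_extensionality_dep => l; exact: addrA. Qed.
Let daddC : commutative dadd.
Proof. by move=> f g; apply: functional_extensionality_dep => l; exact: addrC. Qed.
Let dadd0 : left_id dzero dadd.
Proof. by move=> f; apply: functional_extensionality_dep => l; exact: add0r. Qed.
Let daddN : left_inverse dzero dopp dadd.
Proof. by move=> f; apply: functional_extensionality_dep => l; exact: addNr. Qed.

HB.instance Definition _ :=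
  GRing.isZmodule.Build dprod daddA daddC dadd0 daddN.

Let dscaleA a b f : dscale a (dscale b f) = dscale (a * b) f.
Proof. by apply: functional_extensionality_dep => l; exact: scalerA. Qed.
Let dscale1 : left_id 1 dscale.
Proof. by move=> f; apply: functional_extensionality_dep => l; exact: scale1r. Qed.
Let dscaleDr : right_distributive dscale +%R.
Proof. by move=> a f g; apply: functional_extensionality_dep => l; exact: scalerDr. Qed.
Let dscaleDl f : {morph dscale^~ f : a b / a + b}.
Proof. by move=> a b; apply: functional_extensionality_dep => l; exact: scalerDl. Qed.

HB.instance Definition _ :=
  GRing.Zmodule_isLmodule.Build F dprod dscaleA dscale1 dscaleDr dscaleDl.

Lemma dprodDE (f g : dprod) l : (f + g) l = f l + g l. Proof. by []. Qed.
Lemma dprodZE a (f : dprod) l : (a *: f) l = a *: f l. Proof. by []. Qed.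

End DProd.

Section DProdMap.
Variables (F : fieldType) (L : Type) (V W : L -> lmodType F).
Variable f : forall l, {linear V l -> W l}.

Definition dprod_map (x : dprod V) : dprod W := fun l => f l (x l).

Lemma dprod_map_linear : linear dprod_map.
Proof.
move=> a x y; apply: functional_extensionality_dep => l.
by rewrite /dprod_map !(dprodDE, dprodZE) linearP.
Qed.

HB.instance Definition _ :=
  GRing.isLinear.Build F (dprod V) (dprod W) _ dprod_map dprod_map_linear.

End DProdMap.

Record persistence_module (R : realType) (F : fieldType) := PersistenceModule {
  pm_space :> R -> lmodType F;
  pm_map : forall s t : R, s <= t -> {linear pm_space s -> pm_space t};
  pm_map_id : forall (t : R) (tt : t <= t) (x : pm_space t), pm_map tt x = x;
  pm_map_comp : forall (s t u : R) (st : s <= t) (tu : t <= u) (su : s <= u)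
    (x : pm_space s), pm_map su x = pm_map tu (pm_map st x)
}.

Definition pm_isomorphic (R : realType) (F : fieldType)
    (M N : persistence_module R F) : Prop :=
  exists phi : forall t, {linear M t -> N t},
    (forall t, bijective (phi t)) /\
    (forall s t (st : s <= t) (x : M s),
       phi t (pm_map M st x) = pm_map N st (phi s x)).

(* The image is spanned by finitely many of its elements. *)
Definition finite_rank (F : fieldType) (V W : lmodType F)
    (f : {linear V -> W}) : Prop :=
  exists (n : nat) (u : 'I_n -> V), forall x : V,
    exists c : 'I_n -> F, f x = \sum_(i < n) c i *: f (u i).

Definition q_tame (R : realType) (F : fieldType)
    (M : persistence_module R F) : Prop :=
  forall (s t : R) (st : s < t), finite_rank (pm_map M (ltW st)).

Section Radical.
Variables (R : realType) (F : fieldType) (M : persistence_module R F).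

Definition radical_set (t : R) : set (M t) := [set x |
  exists (n : nat) (s : 'I_n -> R) (st : forall i, s i < t)
         (y : forall i, M (s i)),
    x = \sum_(i < n) pm_map M (ltW (st i)) (y i)].

Lemma radical_set0 t : radical_set (0 : M t).
Proof.
have lt_t : t - 1 < t by rewrite ltrBlDr ltrDl.
exists 0%N, (fun=> t - 1), (fun=> lt_t), (fun=> 0).
by rewrite big_ord0.
Qed.

Lemma radical_setP t (a : F) (x y : M t) :
  radical_set x -> radical_set y -> radical_set (a *: x + y).
Proof.
move=> [n [s [st [u ->]]]] [m [s' [st' [v ->]]]].
pose S (i : 'I_(n + m)) := match fintype.split i with inl j => s j | inr j => s' j end.
have hS i : S i < t by rewrite /S; case: (fintype.split i).
pose Y (i : 'I_(n + m)) : M (S i) :=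
  match fintype.split i as k
    return M (match k with inl j => s j | inr j => s' j end) with
  | inl j => a *: u j
  | inr j => v j
  end.
exists (n + m)%N, S, hS, Y.
rewrite big_split_ord /= scaler_sumr; congr (_ + _); apply: eq_bigr => i _.
- move: (hS (lshift m i)); rewrite /Y /S; case: (split_ordP (lshift m i)) => j.
  + move=> /lshift_inj <- hs.
    by rewrite linearZ /=; congr (_ *: pm_map M _ _); exact: bool_irrelevance.
  + by move=> /eqP; rewrite eq_lrshift.
- move: (hS (rshift n i)); rewrite /Y /S; case: (split_ordP (rshift n i)) => j.
  + by move=> /eqP; rewrite eq_rlshift.
  + move=> /rshift_inj <- hs.
    by congr (pm_map M _ _); exact: bool_irrelevance.
Qed.

Definition radical_space (t : R) : subspace (M t) :=
  Subspace (radical_set0 t) (@radical_setP t).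

Lemma radical_map_subproof s t (st : s <= t) (x : M s) :
  sub_set (radical_space s) x -> sub_set (radical_space t) (pm_map M st x).
Proof.
move=> [n [r [rs [y ->]]]].
exists n, r, (fun i => lt_le_trans (rs i) st), y.
by rewrite linear_sum; apply: eq_bigr => i _; exact/esym/pm_map_comp.
Qed.

Definition radical_map s t (st : s <= t) :
    {linear sub_type (radical_space s) -> sub_type (radical_space t)} :=
  sub_map (@radical_map_subproof s t st).

Lemma radical_map_id t (tt : t <= t) x : radical_map tt x = x.
Proof. by apply: sub_val_inj; rewrite /= pm_map_id. Qed.

Lemma radical_map_comp s t u (st : s <= t) (tu : t <= u) (su : s <= u) x :
  radical_map su x = radical_map tu (radical_map st x).
Proof. by apply: sub_val_inj; exact: pm_map_comp. Qed.

Definition radical : persistence_module R F :=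
  PersistenceModule radical_map_id radical_map_comp.

End Radical.

Record real_interval (R : realType) := RealInterval {
  itv_set : set R;
  itv_setP : is_interval itv_set;
  itv_set_neq0 : itv_set !=set0
}.

Section IntervalModule.
Variables (R : realType) (F : fieldType) (I : real_interval R).

(* The subspace of F that is F itself when t lies in I, and 0 otherwise. *)
Definition interval_space_set (t : R) : set F^o := [set x | itv_set I t \/ x = 0].

Lemma interval_space_set0 t : interval_space_set t 0.
Proof. by right. Qed.

Lemma interval_space_setP t (a : F) (x y : F^o) :
  interval_space_set t x -> interval_space_set t y ->
  interval_space_set t (a *: x + y).
Proof.
move=> [It|->]; first by left.
by case=> [It|->]; [left|right; rewrite scaler0 addr0].
Qed.

Definition interval_space (t : R) : subspace F^o :=
  Subspace (@interval_space_set0 t) (@interval_space_setP t).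

Definition interval_fun (t : R) (x : F^o) : F^o :=
  if `[< itv_set I t >] then x else 0.

Lemma interval_fun_linear t : linear (interval_fun t).
Proof.
by move=> a x y; rewrite /interval_fun; case: ifP; rewrite // scaler0 addr0.
Qed.

HB.instance Definition _ t :=
  GRing.isLinear.Build F F^o F^o _ (interval_fun t) (@interval_fun_linear t).

Lemma interval_map_subproof s t (x : F^o) :
  sub_set (interval_space s) x -> sub_set (interval_space t) (interval_fun t x).
Proof. by move=> _; rewrite /interval_fun; case: asboolP; [left|right]. Qed.

Definition interval_map s t (st : s <= t) :
    {linear sub_type (interval_space s) -> sub_type (interval_space t)} :=
  sub_map (@interval_map_subproof s t).

Lemma interval_map_id t (tt : t <= t) x : interval_map tt x = x.
Proof.
apply: sub_val_inj; rewrite /= /interval_fun.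
by case: x => x /= /asboolP[It|->]; case: asboolP.
Qed.

Lemma interval_map_comp s t u (st : s <= t) (tu : t <= u) (su : s <= u) x :
  interval_map su x = interval_map tu (interval_map st x).
Proof.
apply: sub_val_inj; rewrite /= /interval_fun; case: (asboolP (itv_set I u)) => // Iu.
case: x => x /= /asboolP[Is|->]; last by case: ifP.
by case: asboolP => // -[]; apply: (itv_setP Is Iu); rewrite st tu.
Qed.

Definition interval_module : persistence_module R F :=
  PersistenceModule interval_map_id interval_map_comp.

End IntervalModule.

Section DirectSum.
Variables (R : realType) (F : fieldType) (L : Type).
Variable N : L -> persistence_module R F.

Definition dsum_set (t : R) : set (dprod (fun l => N l t)) :=
  [set x | finite_set [set l | x l <> 0]].

Lemma dsum_set0 t : dsum_set (0 : dprod (fun l => N l t)).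
Proof.
rewrite /dsum_set /=; have -> : [set l | (0 : dprod (fun l => N l t)) l <> 0]
  = set0 by apply/seteqP; split => l //=.
exact: finite_set0.
Qed.

Lemma dsum_setP t (a : F) (x y : dprod (fun l => N l t)) :
  dsum_set x -> dsum_set y -> dsum_set (a *: x + y).
Proof.
move=> fx fy; apply: (@sub_finite_set _ _ ([set l | x l <> 0] `|`
  [set l | y l <> 0])); last by rewrite finite_setU.
move=> l /= h; have [x0|] := pselect (x l = 0); last by left.
right=> y0; apply: h.
by rewrite dprodDE dprodZE x0 y0 scaler0 addr0.
Qed.

Definition dsum_space (t : R) : subspace (dprod (fun l => N l t)) :=
  Subspace (@dsum_set0 t) (@dsum_setP t).

Lemma dsum_map_subproof s t (st : s <= t) (x : dprod (fun l => N l s)) :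
  sub_set (dsum_space s) x ->
  sub_set (dsum_space t) (dprod_map (fun l => pm_map (N l) st) x).
Proof.
apply: sub_finite_set => l /= h x0.
by apply: h; rewrite /dprod_map x0 linear0.
Qed.

Definition dsum_map s t (st : s <= t) :
    {linear sub_type (dsum_space s) -> sub_type (dsum_space t)} :=
  sub_map (@dsum_map_subproof s t st).

Lemma dsum_map_id t (tt : t <= t) x : dsum_map tt x = x.
Proof.
apply: sub_val_inj => /=; apply: functional_extensionality_dep => l.
exact: pm_map_id.
Qed.

Lemma dsum_map_comp s t u (st : s <= t) (tu : t <= u) (su : s <= u) x :
  dsum_map su x = dsum_map tu (dsum_map st x).
Proof.
apply: sub_val_inj => /=; apply: functional_extensionality_dep => l.
exact: pm_map_comp.
Qed.

Definition direct_sum : persistence_module R F :=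
  PersistenceModule dsum_map_id dsum_map_comp.

End DirectSum.

Section Diagram.
Variable R : realType.

(* p < q already forces p to be real or -oo, and q to be real or +oo. *)
Definition diagram_domain : set (\bar R * \bar R) :=
  [set pq | (pq.1 < pq.2)%E].

Definition itv_inf (I : real_interval R) : \bar R := ereal_inf (EFin @` itv_set I).
Definition itv_sup (I : real_interval R) : \bar R := ereal_sup (EFin @` itv_set I).

(* m is the multiplicity function of the persistence diagram of M; only its
   values on diagram_domain are meaningful. *)
Definition is_persistence_diagram (F : fieldType) (M : persistence_module R F)
    (m : \bar R * \bar R -> nat) : Prop :=
  exists (L : Type) (I : L -> real_interval R),
    pm_isomorphic (radical M)
      (direct_sum (fun l => interval_module F (I l))) /\
    forall pq, diagram_domain pq ->
      ([set l | itv_inf (I l) = pq.1 /\ itv_sup (I l) = pq.2]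
        #= `I_(m pq))%card.

Definition alpha (eps : R) (m : \bar R * \bar R -> nat) : \bar R :=
  \esum_(pq in [set pq | diagram_domain pq /\
                         (eps%:E < pq.2 - pq.1)%E /\ pq.1 <> -oo%E])
    (m pq)%:R%:E.

Definition omega (eps : R) (m : \bar R * \bar R -> nat) : \bar R :=
  \esum_(pq in [set pq | diagram_domain pq /\
                         (eps%:E < pq.2 - pq.1)%E /\ pq.2 <> +oo%E])
    (m pq)%:R%:E.

Definition cap_number (eps : R) (m : int -> \bar R * \bar R -> nat) (d : int) :
    \bar R :=
  (alpha eps (m d) + omega eps (m (d - 1)%R))%E.

Definition essential_dim (m : int -> \bar R * \bar R -> nat) (d : int) :
    \bar R :=
  \esum_(p in [set p : \bar R | p <> +oo%E]) (m d (p, +oo%E))%:R%:E.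

End Diagram.

(* Main.v *)
Require Import Defs.
From mathcomp Require Import all_boot all_order all_algebra.
From mathcomp Require Import all_classical all_reals all_analysis.

Import Order.TTheory GRing.Theory Num.Theory.

Local Open Scope classical_set_scope.
Local Open Scope ring_scope.

(** The inequality is a statement about the diagrams alone.  Each point of a
    diagram whose persistence exceeds eps is born at some p and dies at some q.
    When no point is born at -oo, [alpha] counts all of them, [omega] counts
    those that die at a finite time, and the others, which are never too short
    since q - p = +oo for them, are counted by [essential_dim].  Hence
    alpha_d = omega_d + p_d ([alphaE]), and the excess
    c_d - p_d = omega_d + omega_(d-1) ([cap_numberB_essential_dim]): each finite
    bar of degree d is seen once in degree d, by its birth, and once in
    degree d + 1, by its death.  The alternating sum therefore telescopes to
    omega_n + (-1)^n omega_(-1) ([alternating_sum_adjacent]).  Both terms are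
    nonnegative when n is even, and the second one vanishes by hypothesis when
    n is odd.

    The cancellations take place among extended reals, so they require the
    counts to be finite: omega_d is bounded by c_(d+1), and p_d is finite by
    hypothesis. *)

Lemma alternating_sum_adjacent (A : pzRingType) (u : nat -> A) (n : nat) :
  \sum_(0 <= d < n.+1) (-1) ^+ (n - d) * (u d.+1 + u d) =
  u n.+1 + (-1) ^+ n * u 0%N.
Proof.
elim: n => [|n IHn]; first by rewrite big_nat1 subn0 expr0 !mul1r.
rewrite big_nat_recr //= subnn expr0 mul1r.
have -> : \sum_(0 <= d < n.+1) (-1) ^+ (n.+1 - d) * (u d.+1 + u d) =
          - (u n.+1 + (-1) ^+ n * u 0%N).
  rewrite -IHn -sumrN; apply: eq_big_nat => d /andP[_ ltdn].
  by rewrite subSn // exprS mulN1r mulNr.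
by rewrite exprS mulN1r mulNr opprD addrC -addrA addNKr.
Qed.

Section DiagramCounts.
Variables (R : realType) (eps : R).

Lemma alpha_ge0 (m : \bar R * \bar R -> nat) : (0 <= alpha eps m)%E.
Proof. by apply: esum_ge0 => pq _; rewrite lee_fin. Qed.

Lemma omega_ge0 (m : \bar R * \bar R -> nat) : (0 <= omega eps m)%E.
Proof. by apply: esum_ge0 => pq _; rewrite lee_fin. Qed.

Lemma essential_dim_ge0 (m : int -> \bar R * \bar R -> nat) (d : int) :
  (0 <= essential_dim m d)%E.
Proof. by apply: esum_ge0 => p _; rewrite lee_fin. Qed.

(** Essential points, and those born at -oo, have infinite persistence, so the
    threshold eps can only discard points with two finite coordinates, which
    [alpha] and [omega] treat alike.  The two counts thus differ only in the
    essential points, as there are no points born at -oo. *)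
Lemma alphaE (m : int -> \bar R * \bar R -> nat) (d : int) :
  (forall q : \bar R, q <> -oo%E -> m d (-oo%E, q) = 0%N) ->
  alpha eps (m d) = (omega eps (m d) + essential_dim m d)%E.
Proof.
move=> no_noo; pose f pq : \bar R := (m d pq)%:R%:E.
have f_ge0 pq : (0 <= f pq)%E by rewrite lee_fin.
pose ess := [set pq : \bar R * \bar R | pq.1 <> +oo%E /\ pq.2 = +oo%E].
have essE : essential_dim m d = \esum_(pq in ess) f pq.
  rewrite (reindex_esum [set p : \bar R | p <> +oo%E] ess
    (fun p => (p, +oo%E))) //.
  by split => [p //|p p' _ _ []//|[p q] [/= pNoo ->]]; exists p.
have mem_ess pq : (pq \in ess) = (pq.1 != +oo%E) && (pq.2 == +oo%E).
  apply/idP/idP; rewrite inE /ess /=; first by move=> [/eqP -> ->]; rewrite eqxx.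
  by move=> /andP[/eqP ? /eqP].
have mem_long (C1 C2 : \bar R * \bar R -> bool)
    (x : \bar R * \bar R -> \bar R) (z : \bar R) pq :
    (pq \in [set pq | C1 pq /\ C2 pq /\ x pq <> z]) =
    [&& C1 pq, C2 pq & x pq != z].
  apply/idP/idP; rewrite inE /=; first by move=> [-> [-> /eqP]].
  by move=> /and3P[-> -> /eqP].
rewrite essE [alpha _ _]esum_mkcond [omega _ _]esum_mkcond.
rewrite [X in (_ + X)%E]esum_mkcond -esumD; last 2 first.
- by move=> pq _; case: ifP.
- by move=> pq _; case: ifP.
apply: eq_esum => pq _; rewrite /diagram_domain !mem_long mem_ess -/(f pq).
(* Deciding which coordinates are infinite settles the equality pointwise,
   except at the points (-oo, q), which carry no multiplicity. *)
case: pq => -[p| |] [q| |] /=;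
  rewrite ?ltry ?ltNyr ?ltxx ?andbF ?adde0 ?add0e //=.
all: by rewrite /f no_noo.
Qed.

Lemma omega_fin_num (m : int -> \bar R * \bar R -> nat) (d : int) :
  (cap_number eps m (d + 1)%R < +oo)%E -> omega eps (m d) \is a fin_num.
Proof.
move=> cap_fin; rewrite ge0_fin_numE ?omega_ge0 //.
apply: le_lt_trans cap_fin.
by rewrite /cap_number addrK leeDr ?alpha_ge0.
Qed.

Lemma cap_numberB_essential_dim (m : int -> \bar R * \bar R -> nat) (d : int) :
  (forall q : \bar R, q <> -oo%E -> m d (-oo%E, q) = 0%N) ->
  (essential_dim m d < +oo)%E ->
  (cap_number eps m d - essential_dim m d =
   omega eps (m d) + omega eps (m (d - 1)%R))%E.
Proof.
move=> no_noo ess_fin; rewrite /cap_number alphaE // addeAC addeK //.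
by rewrite ge0_fin_numE ?essential_dim_ge0.
Qed.

End DiagramCounts.

Theorem theorem3p3 (R : realType) (F : fieldType) (eps : R)
  (M : int -> persistence_module R F)
  (m : int -> \bar R * \bar R -> nat)
  (eps_gt0 : 0 < eps)
  (M_q_tame : forall d : int, q_tame (M d))
  (m_diagram : forall d : int, is_persistence_diagram (M d) (m d))
  (cap_finite : forall d : int, (cap_number eps m d < +oo)%E)
  (essential_finite : forall d : int, (essential_dim m d < +oo)%E)
  (no_minus_infty : forall (d : int) (p : \bar R), p <> -oo%E ->
     m d (-oo%E, p) = 0%N)
  (n : nat)
  (* The alternating sum equals omega_n + (-1)^n omega_(-1), so that for odd n
     the part in degree -1 has to be excluded; this is automatic for modules
     concentrated in nonnegative degrees. *)
  (omega_neg1 : odd n -> omega eps (m (-1)) = 0%E) :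
  (0 <= \sum_(0 <= d < n.+1)
          ((-1) ^+ (n - d))%:E * (cap_number eps m d%:Z - essential_dim m d%:Z))%E.
Proof.
have omega_fin d : omega eps (m d) \is a fin_num by exact: omega_fin_num.
(* The shift by one lets the index 0 stand for the degree -1. *)
pose u (k : nat) : R := fine (omega eps (m (k%:Z - 1))).
have u_ge0 k : 0 <= u k by rewrite fine_ge0 ?omega_ge0.
have -> : (\sum_(0 <= d < n.+1) ((-1) ^+ (n - d))%:E *
      (cap_number eps m d%:Z - essential_dim m d%:Z))%E =
    (\sum_(0 <= d < n.+1) (-1) ^+ (n - d) * (u d.+1 + u d))%:E.
  rewrite -sumEFin; apply: eq_bigr => d _.
  rewrite cap_numberB_essential_dim //; last exact: no_minus_infty.
  by rewrite EFinM EFinD /u !fineK // -addn1 PoszD addrK.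
rewrite alternating_sum_adjacent lee_fin addr_ge0 //.
rewrite -signr_odd; case: (boolP (odd n)) => [n_odd|_]; last by rewrite mul1r.
by rewrite /u sub0r omega_neg1 //= mulr0.
Qed.
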